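(* A commutative topological semigroup $S$ embeds topologically into $\mathbb{N}^{\mathbb{N}}$ if and only if there exists a countable family $\{S_n : n\in\mathbb{N}\}$ of countable discrete semigroups such that $S$ embeds topologically into the Tychonoff product $\prod_{n\in\mathbb{N}} S_n$.
   Context: A topological semigroup is a semigroup with a topology for which multiplication $S\times S\to S$ is continuous. $\mathbb{N}^{\mathbb{N}}$ is the monoid of all functions $\mathbb{N}\to\mathbb{N}$; functions are written to the right of their arguments and composed from left to right, i.e. $(x)(fg)=((x)f)g$. It carries the product topology arising from the discrete topology on $\mathbb{N}$ (the Baire space topology), and is a topological semigroup. An embedding of semigroups is an injective homomorphism; an embedding $\phi:S\to T$ of topological semigroups is topological if both $\phi$ and $\phi^{-1}:(S)\phi\to S$ are continuous, where $(S)\phi\subseteq T$ has the subspace topology. ''$S$ embeds topologically into $T$'' means such a topological embedding exists. Products of semigroups have coordinatewise multiplication. *)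

(* Defs.v *)
From HB Require Import structures.
From mathcomp Require Import all_boot all_classical topology.

Set Implicit Arguments.
Unset Strict Implicit.
Unset Printing Implicit Defensive.

Local Open Scope classical_set_scope.
Local Open Scope group_scope.

(* No separation axiom is required, and the carrier may be empty. *)
HB.mixin Record isTopologicalSemigroup S & Topological S & Semigroup S := {
  mulg_continuous : continuous (fun xy : S * S => xy.1 * xy.2)
}.

#[short(type="topologicalSemigroupType")]
HB.structure Definition TopologicalSemigroup :=
  {S of Topological S & Semigroup S & isTopologicalSemigroup S}.

Lemma continuous_prod_topology (X : topologicalType) (I : Type)
    (T : I -> topologicalType) (f : X -> prod_topology T) :
  (forall i, continuous (fun x => f x i)) -> continuous f.
Proof.
move=> cf x; apply/cvg_sup => i; move: x.
apply/(@continuousP _ (initial_topology (fun g : forall i, T i => g i))).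
move=> A [B oB <-].
by move/continuousP : (cf i) => /(_ _ oB).
Qed.

Lemma continuous_prod_eval (I : Type) (T : I -> topologicalType) (i : I) :
  continuous (fun f : prod_topology T => f i).
Proof.
move=> f.
have /cvg_sup/(_ i) h : f --> f by exact: cvg_id.
move=> U nU; apply: h.
exact: (@initial_continuous _ _ (fun g : forall i, T i => g i)).
Qed.

Section DiscreteSemigroup.
Variable G : semigroupType.

HB.instance Definition _ := Semigroup.copy (discrete_topology G) G.

Let discrete_mulg_continuous : continuous
  (fun xy : discrete_topology G * discrete_topology G => xy.1 * xy.2).
Proof.
move=> -[x y] A /nbhs_singleton Axy.
exists ([set x], [set y]); first by split; exact: discrete_set1.
by move=> -[_ _] /= [-> ->].
Qed.

HB.instance Definition _ :=
  isTopologicalSemigroup.Build (discrete_topology G) discrete_mulg_continuous.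

End DiscreteSemigroup.

Section ProductSemigroup.
Variables (I : Type) (T : I -> topologicalSemigroupType).

Definition prod_mulg (f g : prod_topology T) : prod_topology T :=
  fun i => f i * g i.

Let prod_mulgA : associative prod_mulg.
Proof.
by move=> f g h; apply: functional_extensionality_dep => i; exact: mulgA.
Qed.

HB.instance Definition _ := isSemigroup.Build (prod_topology T) prod_mulgA.

Let prod_mulg_continuous : continuous
  (fun fg : prod_topology T * prod_topology T => fg.1 * fg.2).
Proof.
apply: continuous_prod_topology => i -[f g].
move=> A /(@mulg_continuous (T i) (f i, g i)) [[U V] [/= Ufi Vgi] UVA].
exists ((fun h => h i) @^-1` U, (fun h => h i) @^-1` V).
  by split; apply: continuous_prod_eval.
by move=> [h k] [/= Uhi Vki]; exact: (UVA (h i, k i)).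
Qed.

HB.instance Definition _ :=
  isTopologicalSemigroup.Build (prod_topology T) prod_mulg_continuous.

End ProductSemigroup.

(* The monoid N^N with the product topology of the discrete space nat. *)
Definition baire_monoid : Type := {ptws nat -> nat}.

HB.instance Definition _ := Topological.copy baire_monoid {ptws nat -> nat}.

(* Functions act on the right: (x)(f g) = ((x)f)g, so that the product f * g
   is g \o f in the usual notation. *)
Definition baire_mul (f g : baire_monoid) : baire_monoid := g \o f.

Fact baire_mulA : associative baire_mul. Proof. by []. Qed.
Fact baire_mul1g : left_id (idfun : baire_monoid) baire_mul. Proof. by []. Qed.
Fact baire_mulg1 : right_id (idfun : baire_monoid) baire_mul. Proof. by []. Qed.

HB.instance Definition _ := isSemigroup.Build baire_monoid baire_mulA.
HB.instance Definition _ := hasOne.Build baire_monoid idfun.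
HB.instance Definition _ :=
  Magma_isUMagma.Build baire_monoid baire_mul1g baire_mulg1.

Fact baire_mul_continuous :
  continuous (fun fg : baire_monoid * baire_monoid => fg.1 * fg.2).
Proof.
apply: continuous_prod_topology => n -[f g] A /nbhs_singleton Afg.
exists ((fun h => h n) @^-1` [set f n], (fun h => h (f n)) @^-1` [set g (f n)]).
  by split; apply: (@continuous_prod_eval _ (fun=> nat)); exact: discrete_set1.
move=> -[f' g'] [/= f'n g'n].
by have -> : (f' * g') n = (f * g) n by exact: etrans (congr1 g' f'n) g'n.
Qed.

HB.instance Definition _ :=
  isTopologicalSemigroup.Build baire_monoid baire_mul_continuous.

(* [range phi], seen as a type, carries the subspace topology; [psi] is the
   inverse of [phi] on its range. *)
Definition topological_embedding (S T : topologicalSemigroupType)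
    (phi : {multiplicative S -> T}) : Prop :=
  [/\ injective phi,
      continuous phi
    & exists psi : range phi -> S,
        (forall y, phi (psi y) = set_val y) /\ continuous psi].

Definition embeds_topologically (S T : topologicalSemigroupType) : Prop :=
  exists phi : {multiplicative S -> T}, topological_embedding phi.

(* Main.v *)
Require Import Defs.
From HB Require Import structures.
From mathcomp Require Import all_boot all_classical topology.

Set Implicit Arguments.
Unset Strict Implicit.
Unset Printing Implicit Defensive.

Local Open Scope classical_set_scope.
Local Open Scope group_scope.

(** Both target semigroups are products of discrete spaces, so a homomorphism
    into either of them is a topological embedding exactly when its coordinates
    separate points and a filter converges as soon as every coordinate is
    eventually constant along it ([embedding_initialP]).  This criterion only
    sees the kernels of the coordinates: two families in which every kernel of
    one contains a kernel of the other satisfy it together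
    ([refines_initial_family]).  The theorem then reduces to algebra.

    If [S] is a commutative semigroup of self-maps of [nat], fix a point [n].
    Having the same value at [n] is a right congruence for any semigroup of
    maps acting on the right, and commutativity makes it two-sided
    ([eval_congruent]).  The quotient by it is the set of images of [n], a
    subset of [nat] and hence countable; the quotient map has the same kernel as the
    evaluation at [n], so the quotients for all [n] give an embedding of [S].

    Conversely, each factor [G n] acts faithfully on itself with an identity
    adjoined by right translations, and the product of the [G n] acts on the
    disjoint union of these sets ([right_regular]).  This union is countable,
    so the action is transported to [nat] ([conjugate]).  The orbit of a point
    of the [n]-th summand depends only on the [n]-th coordinate, and the orbit
    of the adjoined identity determines that coordinate. *)

Lemma initial_topology_cvgP (X : choiceType) (Y : topologicalType) (f : X -> Y)
    (F : set_system (initial_topology f)) (x : initial_topology f) :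
  Filter F -> F --> x <-> f @ F --> f x.
Proof.
move=> FF; split=> [Fx|fFx U].
  by apply: cvg_trans (cvg_app f Fx) _; exact: initial_continuous.
rewrite nbhsE => -[_ [[B oB <-] Bfx] BU].
by apply: filterS BU _; apply: fFx; exact: open_nbhs_nbhs.
Qed.

(** Arbitrary filters replace the neighbourhoods of a point: continuity of
    [phi] and of its inverse become the two directions of one equivalence,
    which no longer mentions the inverse or the range. *)
Lemma topological_embeddingP (S T : topologicalSemigroupType)
    (phi : {multiplicative S -> T}) :
  topological_embedding phi <->
  injective phi /\
  forall (F : set_system S) (s : S), Filter F ->
    F --> s <-> phi @ F --> phi s.
Proof.
split=> [[phiI phi_cont [psi [psiK psi_cont]]]|[phiI phi_cvg]].
  split=> // F s FF; split=> [Fs|phiFs].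
    exact: cvg_trans (cvg_app phi Fs) (phi_cont s).
  pose y t : range phi := SigSub (mem_set (imageT phi t)).
  have psiy t : psi (y t) = t by apply: phiI; rewrite psiK.
  have yF : y @ F --> y s by apply/initial_topology_cvgP.
  have := cvg_trans (cvg_app psi yF) (psi_cont (y s)).
  rewrite psiy -fmap_comp (_ : psi \o y = id) //.
  by apply/funext => t; exact: psiy.
split=> //.
  by move=> s; apply/phi_cvg.
have /choice[psi psiK] (y : range phi) : exists s, phi s = set_val y.
  by have [s _ sy] := set_valP y; exists s.
exists psi; split=> // y.
apply/phi_cvg; first exact: fmap_filter (nbhs_filter y).
rewrite psiK -[X in X --> _]/((phi \o psi) @ nbhs y).
rewrite (_ : phi \o psi = set_val); first exact: initial_continuous.
exact/funext.
Qed.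

(** An initial family presents a space as a subspace of the product of the
    discrete spaces [T i]. *)
Definition initial_family (S : topologicalType) (I : Type) (T : I -> Type)
    (f : forall i, S -> T i) : Prop :=
  (forall s t, (forall i, f i s = f i t) -> s = t) /\
  forall (F : set_system S) (s : S), Filter F ->
    F --> s <-> forall i, \forall t \near F, f i t = f i s.

Definition refines (S I J : Type) (T : I -> Type) (U : J -> Type)
    (f : forall i, S -> T i) (g : forall j, S -> U j) : Prop :=
  forall j, exists i, forall s t, f i s = f i t -> g j s = g j t.

Lemma refines_initial_family (S : topologicalType) (I J : Type)
    (T : I -> Type) (U : J -> Type)
    (f : forall i, S -> T i) (g : forall j, S -> U j) :
  refines f g -> refines g f -> initial_family f -> initial_family g.
Proof.
move=> fg gf [f_sep f_cvg]; split=> [s t gst|F s FF].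
  by apply: f_sep => i; have [j] := gf i; apply.
apply: iff_trans (f_cvg F s FF) _; split=> [Ff j|Fg i].
  by have [i fgij] := fg j; apply: filterS (Ff i) => t; exact: fgij.
by have [j gfij] := gf i; apply: filterS (Fg j) => t; exact: gfij.
Qed.

Lemma prod_discrete_initial_family (I : Type)
    (T : I -> discreteTopologicalType) :
  initial_family (fun i (f : prod_topology T) => f i).
Proof.
split=> [f g fg|F f FF]; first exact: functional_extensionality_dep.
split=> [Ff i|Ff].
  apply: (Ff [set g | g i = f i]).
  exact: (@continuous_prod_eval _ T i f [set f i] (discrete_set1 _)).
apply/cvg_sup => i; apply/initial_topology_cvgP => U /nbhs_singleton Ufi.
by apply: filterS (Ff i) => g /= ->.
Qed.

Lemma embedding_initialP (S T : topologicalSemigroupType) (I : Type)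
    (V : I -> Type) (f : forall i, T -> V i) (phi : {multiplicative S -> T}) :
  initial_family f ->
  topological_embedding phi <-> initial_family (fun i s => f i (phi s)).
Proof.
move=> [f_sep f_cvg]; apply: iff_trans (topological_embeddingP phi) _.
split=> [[phiI phi_cvg]|[phi_sep phi_cvg]]; split.
- by move=> s t st; apply: phiI; exact: f_sep.
- by move=> F s FF; apply: iff_trans (phi_cvg F s FF) _; exact: f_cvg.
- by move=> s t st; apply: phi_sep => i; rewrite st.
- move=> F s FF; apply: iff_trans (phi_cvg F s FF) _; apply: iff_sym.
  exact: f_cvg.
Qed.

Lemma prod_discrete_embeddingP (S : topologicalSemigroupType) (I : Type)
    (G : I -> semigroupType)
    (phi : {multiplicative
              S -> prod_topology (fun i => discrete_topology (G i))}) :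
  topological_embedding phi <-> initial_family (fun i s => phi s i).
Proof.
exact: (embedding_initialP phi
  (@prod_discrete_initial_family _ (fun i => discrete_topology (G i)))).
Qed.

Lemma baire_embeddingP (S : topologicalSemigroupType)
    (phi : {multiplicative S -> baire_monoid}) :
  topological_embedding phi <-> initial_family (fun n s => phi s n).
Proof.
exact: (embedding_initialP phi
  (@prod_discrete_initial_family _ (fun=> nat))).
Qed.

Section ImageSemigroup.
Variables (S : semigroupType) (T : choiceType) (f : S -> T).

Definition congruent : Prop := forall s s' t t',
  f s = f s' -> f t = f t' -> f (s * t) = f (s' * t').

(** The quotient of [S] by the kernel of [f], realised inside [T] so that it
    inherits countability from [T].  The proof that the kernel is a congruence
    is an argument of the type because the multiplication depends on it. *)
Definition image_of of congruent : Type := range f.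

Hypothesis f_congr : congruent.

HB.instance Definition _ := Choice.copy (image_of f_congr) (range f).

Definition to_image (s : S) : image_of f_congr :=
  SigSub (mem_set (imageT f s)).

Lemma to_image_eq s t : to_image s = to_image t <-> f s = f t.
Proof. by split=> [/(congr1 set_val)|fst] //; exact/val_inj. Qed.

Lemma to_image_surj y : exists s, to_image s = y.
Proof. by have [s _ sy] := set_valP y; exists s; exact/val_inj. Qed.

Definition preimage_choice y : S := sval (cid (to_image_surj y)).

Lemma preimage_choiceK : cancel preimage_choice to_image.
Proof. by move=> y; exact: (svalP (cid (to_image_surj y))). Qed.

Definition image_mul y z := to_image (preimage_choice y * preimage_choice z).

Lemma to_imageM : {morph to_image : s t / s * t >-> image_mul s t}.
Proof.
move=> s t; apply/to_image_eq/f_congr; apply/to_image_eq;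
  by rewrite preimage_choiceK.
Qed.

Lemma image_mulA : associative image_mul.
Proof.
move=> x y z; rewrite -[x]preimage_choiceK -[y]preimage_choiceK.
by rewrite -[z]preimage_choiceK -!to_imageM mulgA.
Qed.

HB.instance Definition _ := isSemigroup.Build (image_of f_congr) image_mulA.

HB.instance Definition _ :=
  isMultiplicative.Build S (image_of f_congr) to_image to_imageM.

Lemma countable_image :
  countable [set: T] -> countable [set: image_of f_congr].
Proof.
move=> /countable_injP[c cI]; apply/countable_injP.
exists (c \o set_val) => x y _ _ /cI.
by rewrite !inE => /(_ I I)/val_inj.
Qed.

End ImageSemigroup.

(** With maps written on the right, [n(st) = (ns)t] depends on [s] only through
    [ns]; since also [n(st) = n(ts) = (nt)s], it depends on [t] only through
    [nt]. *)
Lemma eval_congruent (S : semigroupType)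
    (phi : {multiplicative S -> baire_monoid}) (n : nat) :
  (forall x y : S, x * y = y * x) -> congruent (fun s => phi s n).
Proof.
move=> S_comm s s' t t' ss' tt'.
have phiM x y : phi (x * y) n = phi y (phi x n) by rewrite gmulfM.
by rewrite phiM ss' -phiM S_comm phiM tt' -phiM S_comm.
Qed.

Section Conjugation.
Variables (X : Type) (c : X -> nat).
Hypothesis c_inj : injective c.

(** Off the range of [c], the transported map is the identity; this choice
    keeps the transport compatible with composition. *)
Definition conjugate (g : X -> X) : baire_monoid := fun k =>
  if pselect (exists x, c x = k) is left kP then c (g (sval (cid kP))) else k.

Lemma conjugateE g x : conjugate g (c x) = c (g x).
Proof.
rewrite /conjugate; case: pselect => [kP|[]]; last by exists x.
by congr (c (g _)); exact/c_inj/(svalP (cid kP)).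
Qed.

Lemma conjugate_out g k : ~ (exists x, c x = k) -> conjugate g k = k.
Proof. by rewrite /conjugate; case: pselect. Qed.

Lemma conjugate_comp g h : conjugate (h \o g) = conjugate g * conjugate h.
Proof.
apply/funext => k; rewrite -[RHS]/(conjugate h (conjugate g k)).
have [[x <-]|kP] := pselect (exists x, c x = k); first by rewrite !conjugateE.
by rewrite !conjugate_out.
Qed.

End Conjugation.

(** In each summand [None] stands for the adjoined identity.  It makes the
    action faithful: right translations of a semigroup without identity may
    coincide. *)
Definition right_regular (I : Type) (G : I -> semigroupType)
    (s : forall i, G i) (x : {i & option (G i)}) : {i & option (G i)} :=
  let: existT i a := x in
  Tagged (fun i => option (G i)) (Some (if a is Some b then b * s i else s i)).

Lemma right_regularM (I : Type) (G : I -> semigroupType) (s t : forall i, G i) :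
  right_regular (fun i => s i * t i) = right_regular t \o right_regular s.
Proof. by apply/funext => -[i [b|]] //=; rewrite mulgA. Qed.

Lemma countable_sum_code (G : nat -> choiceType) :
  (forall n, countable [set: G n]) ->
  exists c : {n & option (G n)} -> nat, injective c.
Proof.
move=> G_countable.
have /all_sig[c cI] n : {c : G n -> nat | injective c}.
  have /countable_injP/cid[c cI] := G_countable n.
  by exists c => x y; apply: cI; rewrite inE.
pose code (x : {n & option (G n)}) := (tag x, omap (c (tag x)) (tagged x)).
exists (pickle \o code); apply: inj_comp (pcan_inj pickleK) _.
by move=> [n x] [m y] [/= nm]; move: nm y => <- y /(inj_omap (cI n)) ->.
Qed.

Theorem theorem2p1 (S : topologicalSemigroupType)
    (S_commutative : forall x y : S, (x * y = y * x)%g) :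
  embeds_topologically S baire_monoid <->
  exists S_ : nat -> semigroupType,
    (forall n : nat, countable [set: S_ n]) /\
    embeds_topologically S (prod_topology (fun n => discrete_topology (S_ n))).
Proof.
split=> [[phi /baire_embeddingP phi_init]|].
  have congr n := @eval_congruent S phi n S_commutative.
  exists (fun n => image_of (congr n)); split.
    by move=> n; exact/countable_image/countableP.
  pose psi (s : S) :
      prod_topology (fun n => discrete_topology (image_of (congr n))) :=
    fun n => to_image (congr n) s.
  have psiM : {morph psi : s t / s * t}.
    by move=> s t; apply: functional_extensionality_dep => n; exact: gmulfM.
  exists (HB.pack_for {multiplicative S -> _} psi
            (isMultiplicative.Build S _ psi psiM)).
  apply/prod_discrete_embeddingP.
  apply: refines_initial_family phi_init => n; exists n => s t st.
    exact/to_image_eq.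
  exact/(to_image_eq (congr n)).
move=> [G [/countable_sum_code[c cI] [phi /prod_discrete_embeddingP phi_init]]].
pose psi (s : S) := conjugate c (right_regular (phi s)).
have psiM : {morph psi : s t / s * t}.
  by move=> s t; rewrite /psi gmulfM right_regularM conjugate_comp.
exists (HB.pack_for {multiplicative S -> _} psi
          (isMultiplicative.Build S _ psi psiM)).
apply/baire_embeddingP.
apply: refines_initial_family phi_init => [k|n].
  have [[[n a] <-]|kP] := pselect (exists x, c x = k).
    by exists n => s t st /=; rewrite /psi !conjugateE //= st.
  (* Such a [k] is fixed by every [psi s], so any index serves. *)
  by exists 0 => s t _ /=; rewrite /psi !conjugate_out.
(* The orbit of the identity of the [n]-th summand recovers [phi s n]. *)
exists (c (existT _ n None)) => s t /=; rewrite /psi !conjugateE // => /cI /=.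
by move/eqP; rewrite eq_Tagged /= => /eqP[].
Qed.
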